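(* Let $N,K\in\mathbb{N}$, $\tau\in\mathbb{N}_0$, and for $i,j\in\{1,\ldots,N\}$, $k\in\{1,\ldots,K\}$ let $c_i:\mathbb{N}_0\to(-1,1)$, $\tau_{ijk}:\mathbb{N}_0\to\mathbb{N}_0$, $b_{ijk},I_i:\mathbb{N}_0\to\mathbb{R}$ and $f_{ijk}:\mathbb{R}\to\mathbb{R}$ be functions. Assume that the functions $b_{ijk}$ and $\tau_{ijk}$ are bounded, and that for each $i,j,k$ there is a constant $F_{ijk}$ such that $|f_{ijk}(x)-f_{ijk}(y)|\le F_{ijk}|x-y|$ for all $x,y\in\mathbb{R}$. Let $c_i^+=\sup_{m}|c_i(m)|$ and $b_{ijk}^+=\sup_m|b_{ijk}(m)|$, and let $\mathcal{M}$ be the $N\times N$ matrix $$\mathcal{M}=\mathcal{I}-\mathrm{diag}(c_1^+,\ldots,c_N^+)-\left[\sum_{k=1}^K b_{ijk}^+F_{ijk}\right]_{i,j=1}^N,$$ where $\mathcal{I}$ is the $N\times N$ identity matrix. If $\mathcal{M}$ is a non-singular M-matrix, then the model $$x_i(m+1)=c_i(m)\,x_i(m-\tau)+\sum_{j=1}^N\sum_{k=1}^K b_{ijk}(m)f_{ijk}\big(x_j(m-\tau_{ijk}(m))\big)+I_i(m),\quad m\in\mathbb{N}_0,\ i\in\{1,\ldots,N\},$$ is globally exponentially stable.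
   Context: $\mathbb{N}=\{1,2,\ldots\}$, $\mathbb{N}_0=\mathbb{N}\cup\{0\}$. Put $r=-\max_{i,j,k,m}\{\tau_{ijk}(m),\tau\}$ (maximum over all indices and all $m\in\mathbb{N}_0$). For $I\subseteq\mathbb{R}$, $I_{\mathbb{Z}}=I\cap\mathbb{Z}$. $X$ is the space of functions $\alpha:[r,0]_{\mathbb{Z}}\to\mathbb{R}$ with norm $\|\alpha\|=\max_{j=r,\ldots,0}|\alpha(j)|$. $X^N$ carries the norm $\|\overline\alpha\|=\max_{i=1,\ldots,N}\|\alpha_i\|$. For $\overline{x}=(x_1,\ldots,x_N):[r,+\infty)_{\mathbb{Z}}\to\mathbb{R}^N$ and $m\in\mathbb{N}_0$, $\overline{x}_m\in X^N$ is defined by $\overline{x}_m(j)=\overline{x}(m+j)$, $j=r,\ldots,0$. For $\overline\alpha\in X^N$, $\overline{x}(\cdot,\overline\alpha)$ is the unique solution with $\overline{x}_0=\overline\alpha$, and $\overline{x}_m(\cdot,\overline\alpha)$ is its segment at time $m$. The model is globally exponentially stable if there are $C>0$ and $\zeta\in(0,1)$ such that $\|\overline{x}_m(\cdot,\overline\alpha)-\overline{x}_m(\cdot,\overline\beta)\|\le C\zeta^m\|\overline\alpha-\overline\beta\|$ for all $\overline\alpha,\overline\beta\in X^N$ and $m\in\mathbb{N}_0$. A non-singular M-matrix is a real square matrix with non-positive off-diagonal entries all of whose eigenvalues have positive real part (equivalently, with all principal minors positive). *)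

(* Defs.v *)
From HB Require Import structures.
From mathcomp Require Import all_boot all_order all_algebra.
From mathcomp Require Import all_classical all_reals all_analysis.
From mathcomp Require Import complex.
From mathcomp Require Import zify.

Set Implicit Arguments.
Unset Strict Implicit.
Unset Printing Implicit Defensive.

Import Order.TTheory GRing.Theory Num.Theory.
Import numFieldNormedType.Exports.
Local Open Scope classical_set_scope.
Local Open Scope ring_scope.

(* [eigenvalue] only sees the eigenvalues lying in the base field, hence the
   passage to the complex numbers [R[i]]. *)
Definition nonsingular_M_matrix (R : realType) (n : nat) (A : 'M[R]_n) : Prop :=
  (forall i j, i != j -> A i j <= 0) /\
  (forall z : R[i], eigenvalue (map_mx (real_complex R) A) z ->
    0 < complex.Re z).

Definition supabs (R : realType) (u : nat -> R) : R :=
  sup (range (fun m => `|u m|)).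

Definition stability_matrix (R : realType) (N K : nat)
    (c : 'I_N -> nat -> R) (b : 'I_N -> 'I_N -> 'I_K -> nat -> R)
    (F : 'I_N -> 'I_N -> 'I_K -> R) : 'M[R]_N :=
  1%:M - diag_mx (\row_i supabs (c i))
  - \matrix_(i, j) \sum_(k < K) supabs (b i j k) * F i j k.

Record model (R : realType) (N K : nat) := Model {
  leak : 'I_N -> nat -> R;
  leak_delay : nat;
  delay : 'I_N -> 'I_N -> 'I_K -> nat -> nat;
  weight : 'I_N -> 'I_N -> 'I_K -> nat -> R;
  activation : 'I_N -> 'I_N -> 'I_K -> R -> R;
  input : 'I_N -> nat -> R
}.

(* This is [- r].  The supremum of a nonempty bounded set of natural numbers is
   its maximum; the value is irrelevant for unbounded delays. *)
Definition max_delay (R : realType) (N K : nat) (S : model R N K) : nat :=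
  supremum 0%N [set n : nat |
    n = leak_delay S \/ exists i j k m, n = delay S i j k m].

(* A history is an element of X^N for r = - d: the entry (i, l) of the matrix is
   the value of its i-th component at time - l. *)
Notation history R N d := 'M[R]_(N, d.+1).

(* `|_| on row vectors is the maximum norm, i.e., the norm of X. *)
Definition history_norm (R : realType) (N d : nat) (a : history R N d) : R :=
  \big[Num.max/0]_(i < N) `|row i a|.

Section Dynamics.
Context (R : realType) (N K : nat).
Implicit Types (S : model R N K) (x : 'I_N -> int -> R).

(* Trajectories are total functions on the integers; for the histories of
   length [max_delay S] used below, only their values at times at least
   [- max_delay S] are meaningful, see [solution_unique]. *)
Definition segment (d : nat) x (m : nat) : history R N d :=
  \matrix_(i, l) x i (m%:Z - l%:Z).

Definition next_state S x (m : nat) (i : 'I_N) : R :=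
  leak S i m * x i (m%:Z - (leak_delay S)%:Z)
  + \sum_(j < N) \sum_(k < K) weight S i j k m *
      activation S i j k (x j (m%:Z - (delay S i j k m)%:Z))
  + input S i m.

Definition is_solution S (d : nat) (a : history R N d) x : Prop :=
  segment d x 0 = a /\
  forall (m : nat) (i : 'I_N), x i (m.+1)%:Z = next_state S x m i.

Lemma eq_next_state S x y m :
  (forall i (t : int), t <= m%:Z -> x i t = y i t) ->
  next_state S x m =1 next_state S y m.
Proof.
move=> xy i; rewrite /next_state xy; last by lia.
congr (_ + _ + _); apply: eq_bigr => j _; apply: eq_bigr => k _.
by rewrite xy//; lia.
Qed.

Lemma solution_exists S d (a : history R N d) :
  exists x : 'I_N -> int -> R, is_solution S a x.
Proof.
pose h0 (i : 'I_N) (t : int) : R := a i (inord `|t|%N).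
pose step m x (i : 'I_N) (t : int) : R :=
  if t == m.+1%:Z then next_state S x m i else x i t.
pose h := fix h n := if n is m.+1 then step m (h m) else h0.
have hS m n i (t : int) : t <= m%:Z -> h (m + n)%N i t = h m i t.
  move=> tm; elim: n => [|n IHn]; first by rewrite addn0.
  rewrite addnS /= /step ifF //; apply/negbTE/eqP => tE.
  by move: tm; rewrite tE; lia.
exists (fun i t => h `|t|%N i t); split.
  apply/matrixP => i l; rewrite mxE.
  have -> : h `|0%:Z - l%:Z|%N i (0%:Z - l%:Z) = h 0%N i (0%:Z - l%:Z).
    by rewrite -[`|_|%N]add0n; apply: hS; lia.
  rewrite /= /h0; congr (a i _); apply: val_inj => /=.
  by rewrite (_ : `|0%:Z - l%:Z|%N = l) ?inordK//; lia.
move=> m i; rewrite /= /step eqxx; apply: eq_next_state => {}i t tm.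
case: (leP 0 t) => t0; first by rewrite -(hS `|t|%N (m - `|t|)%N) ?subnKC//; lia.
have -> : h m i t = h 0%N i t by rewrite -[m]add0n; apply: hS; lia.
by rewrite -[`|t|%N]add0n; apply/esym; apply: hS; lia.
Qed.

Lemma max_delay_ub S :
  (forall i j k, exists B : nat, forall m, (delay S i j k m <= B)%N) ->
  (leak_delay S <= max_delay S)%N /\
  forall i j k m, (delay S i j k m <= max_delay S)%N.
Proof.
move=> bd.
pose E := [set n : nat |
  n = leak_delay S \/ exists i j k m, n = delay S i j k m].
have /choice[B hB] : forall p : 'I_N * 'I_N * 'I_K, exists B : nat,
    forall m, (delay S p.1.1 p.1.2 p.2 m <= B)%N by move=> p; exact: bd.
have E0 : supremums E !=set0.
  apply: nat_supremums_neq0; exists (maxn (leak_delay S) (\max_p B p)).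
  move=> n [->|[i [j [k [m ->]]]]]; rewrite leEnat leq_max ?leqnn//.
  apply/orP; right; apply: (leq_trans (hB (i, j, k) m)).
  exact: (leq_bigmax (i, j, k)).
have ub n : E n -> (n <= max_delay S)%N.
  by move=> En; rewrite -leEnat; exact: ge_supremum_Nmem.
split=> [|i j k m]; apply: ub; first by left.
by right; exists i, j, k, m.
Qed.

Lemma solution_unique S (a : history R N (max_delay S)) x y :
  (forall i j k, exists B : nat, forall m, (delay S i j k m <= B)%N) ->
  is_solution S a x -> is_solution S a y ->
  forall i (t : int), - (max_delay S)%:Z <= t -> x i t = y i t.
Proof.
move=> /max_delay_ub[ld dl] [x0 xS] [y0 yS].
suff H n i (t : int) : - (max_delay S)%:Z <= t -> t <= n%:Z -> x i t = y i t.
  by move=> i t dt; apply: (H `|t|%N) => //; lia.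
elim: n i t => [|n IHn] i t dt tn.
  have lt : (`|t| < (max_delay S).+1)%N by lia.
  have := congr1 (fun A : history R N (max_delay S) => A i (Ordinal lt))
    (etrans x0 (esym y0)).
  by rewrite !mxE /= (_ : 0%:Z - `|t|%N%:Z = t)//; lia.
have [->|tn'] := eqVneq t n.+1%:Z; last by apply: IHn => //; lia.
rewrite xS yS /next_state IHn; [|lia..].
congr (_ + _ + _); apply: eq_bigr => j _; apply: eq_bigr => k _.
by have dn := dl i j k n; rewrite IHn//; lia.
Qed.

(* Determined by [a] at the meaningful times only, see [solution_unique]. *)
Definition solution S (d : nat) (a : history R N d) : 'I_N -> int -> R :=
  sval (cid (solution_exists S a)).

End Dynamics.

Definition globally_exponentially_stable (R : realType) (N K : nat)
    (S : model R N K) : Prop :=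
  exists C zeta : R, 0 < C /\ 0 < zeta < 1 /\
  forall (a b : history R N (max_delay S)) (m : nat),
    history_norm (segment (max_delay S) (solution S a) m
                  - segment (max_delay S) (solution S b) m)
    <= C * zeta ^+ m * history_norm (a - b).

(* Main.v *)
Require Import Defs.
From mathcomp Require Import all_boot all_order all_algebra.
From mathcomp Require Import all_classical all_reals all_analysis.
From mathcomp Require Import complex lra ring zify.

Import Order.TTheory GRing.Theory Num.Theory.
Local Open Scope ring_scope.

(** The spectral hypothesis enters only through a positive vector [d] with
    [M d > 0], where [M] is the stability matrix
    ([nonsingular_M_matrix_semipositive]).  Spelled out, [M d > 0] says that the
    nonnegative matrix [P = 1 - M] of the Lipschitz bounds satisfies [P d < d],
    so a new difference of states, measured by [|z_i| / d_i], is smaller by a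
    fixed factor than the largest of the past ones it depends on, whatever the
    delays are.

    To find [d], consider the shifts [M + t] with [t >= 0].  They are all
    invertible, because a singular one would give [M] the eigenvalue [- t].
    The set of the [t] for which [M + t] maps some positive vector to a positive
    vector contains all large [t].  It is closed: near its infimum the shifted
    matrices are monotone ([Z_matrix_monotone]), which makes the solution [x] of
    [(M + t) x = 1] at the infimum positive ([semipositive_closed]).  It is open
    because strict inequalities survive small shifts ([semipositive_open]).
    Hence the infimum is [0] and [0] is attained.

    For the decay, let [T] be the largest delay.  As [P d < d], there is a rate
    [zeta] in [(0, 1)] with [P d <= zeta ^ (T + 1) d] ([exists_rate]).  If the
    difference [z] of two solutions obeys [|z_i(t)| <= D zeta ^ t d_i] up to time
    [m], then every delayed value read by the step to [m + 1] is at most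
    [D zeta ^ (m - T) d_j], and the step gains the factor [zeta ^ (T + 1)]:
    the bound propagates ([difference_decay]). *)

(** * Nonsingular M-matrices have a positive vector with positive image *)

Definition Z_matrix {R : numDomainType} {n : nat} (A : 'M[R]_n) : Prop :=
  forall i j, i != j -> A i j <= 0.

Definition semipositive {R : numDomainType} {n : nat} (A : 'M[R]_n) : Prop :=
  exists2 d : 'cV[R]_n, forall i, 0 < d i 0 & forall i, 0 < (A *m d) i 0.

Lemma fin_pos_lower_bound {R : realFieldType} {n : nat} (g : 'I_n -> R) :
  (forall i, 0 < g i) -> exists2 e, 0 < e & forall i, e <= g i.
Proof.
move=> g0; exists (\big[Num.min/1]_i g i); last by move=> i; exact: bigmin_le.
by apply: lt_bigmin => // i _; exact: g0.
Qed.

(** Subtract from [x] the multiple of [d] given by the least ratio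
    [x_k / d_k = r]: the result is nonnegative and vanishes at [k], so row [k]
    of [A] maps it to a nonpositive number.  If [r < 0] this contradicts
    [(A x)_k - r (A d)_k > 0]. *)
Lemma Z_matrix_monotone {R : realFieldType} {n : nat} (A : 'M[R]_n)
    (x : 'cV[R]_n) :
  Z_matrix A -> semipositive A ->
  (forall i, 0 <= (A *m x) i 0) -> forall i, 0 <= x i 0.
Proof.
move=> AZ [d d0 Ad0] Ax0 i; rewrite leNgt; apply/negP => xi.
case: (arg_minP (fun k => x k 0 / d k 0) (erefl : xpredT i)) => k _ kmin.
set r := x k 0 / d k 0 in kmin.
have r0 : r < 0 by apply: le_lt_trans (kmin i erefl) _; rewrite pmulr_llt0 ?invr_gt0.
pose y := x - r *: d.
have y0 j : 0 <= y j 0.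
  by rewrite !mxE subr_ge0 -ler_pdivlMr //; exact: kmin.
have yk : y k 0 = 0 by rewrite !mxE /r divfK ?subrr // gt_eqF.
have : (A *m y) k 0 <= 0.
  rewrite mxE; apply: sumr_le0 => j _.
  have [<-|kj] := eqVneq k j; first by rewrite yk mulr0.
  by apply: mulr_le0_ge0; [exact: AZ|exact: y0].
rewrite leNgt => /negP; apply.
rewrite mulmxBr -scalemxAr !mxE subr_gt0.
have := Ax0 k; have := Ad0 k; rewrite !mxE => h1 h2.
by apply: lt_le_trans h2; rewrite nmulr_rlt0.
Qed.

Lemma Z_matrix_addscalar {R : numDomainType} {n : nat} (A : 'M[R]_n) (s : R) :
  Z_matrix A -> Z_matrix (A + s%:M).
Proof. by move=> AZ i j ij; rewrite !mxE (negbTE ij) mulr0n addr0; exact: AZ. Qed.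

Lemma mulmx_addscalar {R : comNzRingType} {n : nat} (A : 'M[R]_n) (s : R)
  (x : 'cV[R]_n) i : ((A + s%:M) *m x) i 0 = (A *m x) i 0 + s * x i 0.
Proof. by rewrite mulmxDl mul_scalar_mx mxE [X in _ + X]mxE. Qed.

Lemma semipositive_large_shift {R : realFieldType} {n : nat} (A : 'M[R]_n) :
  exists2 t, 0 <= t & semipositive (A + t%:M).
Proof.
pose t : R := 1 + \sum_i \sum_j `|A i j|.
have S0 : 0 <= \sum_i \sum_j `|A i j| by do 2!(apply: sumr_ge0 => ? _).
exists t; first by rewrite addr_ge0.
exists (const_mx 1) => i; first by rewrite mxE.
rewrite mulmx_addscalar !mxE mulr1 addrCA ltr_wpDr //.
rewrite -lerBlDl sub0r; apply: (@le_trans _ _ (\sum_j `|A i j|)); last first.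
  by rewrite [leRHS](bigD1 i) //= lerDl; do 2!(apply: sumr_ge0 => ? _).
rewrite -sumrN; apply: ler_sum => j _; rewrite mxE mulr1.
by rewrite -normrN ler_norm.
Qed.

Lemma semipositive_open {R : realFieldType} {n : nat} (A : 'M[R]_n) :
  semipositive A -> exists2 e, 0 < e & semipositive (A + (- e)%:M).
Proof.
move=> [d d0 Ad0].
have [i|e e0 eP] := fin_pos_lower_bound (fun i => (A *m d) i 0 / d i 0).
  by rewrite divr_gt0.
exists (e / 2); first by rewrite divr_gt0.
exists d => // i; rewrite mulmx_addscalar mulNr subr_gt0.
apply: (@lt_le_trans _ _ (e * d i 0)); last by rewrite -ler_pdivlMr.
by rewrite ltr_pM2r // ltr_pdivrMr // ltr_pMr // ltr1n.
Qed.

(** The witness is the solution of [A x = 1].  For small [s] the vector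
    [(A + s) x = 1 + s x] is still nonnegative, so monotonicity of [A + s] gives
    [x >= 0].  No entry of [x] vanishes: at such an entry the Z-sign pattern
    would force [(A x)_i <= 0]. *)
Lemma semipositive_closed {R : realFieldType} {n : nat} (A : 'M[R]_n) :
  Z_matrix A -> A \in unitmx ->
  (forall e, 0 < e -> exists2 s, 0 <= s < e & semipositive (A + s%:M)) ->
  semipositive A.
Proof.
move=> AZ Au near.
pose x : 'cV[R]_n := invmx A *m const_mx 1.
have Ax : A *m x = const_mx 1 by rewrite mulmxA mulmxV // mul1mx.
have [i|e e0 eP] := fin_pos_lower_bound (fun i => (1 + `|x i 0|)^-1).
  by rewrite invr_gt0 ltr_pwDl.
have [s /andP[s0 se] sA] := near _ e0.
have x0 : forall i, 0 <= x i 0.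
  apply: Z_matrix_monotone sA _ => [|i]; first exact: Z_matrix_addscalar.
  rewrite mulmx_addscalar Ax mxE -lerBlDl sub0r.
  (* [e] was chosen so that [s |x_i| <= 1] for every [s < e] *)
  have h1 : s * (1 + `|x i 0|) <= 1.
    rewrite -ler_pdivlMr ?ltr_pwDl // div1r.
    exact: le_trans (ltW se) (eP i).
  have h2 : - x i 0 <= `|x i 0| by rewrite -normrN ler_norm.
  have : 0 <= s * (`|x i 0| + x i 0) by rewrite mulr_ge0 // -lerBlDr sub0r.
  by move: h1; rewrite !mulrDr mulr1; lra.
exists x => i; last by rewrite Ax mxE.
rewrite lt_neqAle x0 andbT; apply/eqP => xi0.
have : (A *m x) i 0 <= 0.
  rewrite mxE; apply: sumr_le0 => j _.
  have [<-|ij] := eqVneq i j; first by rewrite -xi0 mulr0.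
  by apply: mulr_le0_ge0; [exact: AZ|exact: x0].
by rewrite Ax mxE ler10.
Qed.

(** If [A + t] were singular, [- t] would be an eigenvalue of [A] with
    nonpositive real part. *)
Lemma nonsingular_M_matrix_unit {R : realType} {n : nat} (A : 'M[R]_n) (t : R) :
  nonsingular_M_matrix A -> 0 <= t -> A + t%:M \in unitmx.
Proof.
move=> [_ eigA] t0; apply/negPn/negP => Au.
have : eigenvalue (map_mx (real_complex R) A) (real_complex R (- t)).
  rewrite /eigenvalue /eigenspace kermx_eq0 -map_scalar_mx -map_mxB row_free_map.
  by rewrite row_free_unit raddfN opprK.
by move=> /eigA /=; rewrite oppr_gt0 ltNge t0.
Qed.

Lemma nonsingular_M_matrix_semipositive {R : realType} {n : nat} (A : 'M[R]_n) :
  nonsingular_M_matrix A -> semipositive A.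
Proof.
move=> AM; have AZ : Z_matrix A by case: AM.
pose G := [set t : R | 0 <= t /\ semipositive (A + t%:M)]%classic.
have Ginf : has_inf G.
  split; last by exists 0 => t [].
  by have [t t0 At] := semipositive_large_shift A; exists t.
have t0 : 0 <= inf G by apply: lb_le_inf => [|t []//]; case: Ginf.
have A0 : semipositive (A + (inf G)%:M).
  apply: semipositive_closed; first exact: Z_matrix_addscalar.
    exact: nonsingular_M_matrix_unit.
  move=> e e0; have [t Gt te] := inf_adherent e0 Ginf.
  exists (t - inf G).
    by rewrite subr_ge0 ge_inf ?ltrBlDl //; case: Ginf.
  by rewrite -addrA -raddfD /= subrKC; case: Gt.
have [e e0 Ae] := semipositive_open _ A0.
rewrite -addrA -raddfD /= in Ae.
(* Either [inf G - e] is a smaller element of [G], which is absurd, or it is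
   negative and moving up to the shift [0] only helps. *)
have [ei|ei] := leP e (inf G).
  have : inf G <= inf G - e.
    by apply: ge_inf; [case: Ginf|split=> //; rewrite subr_ge0].
  by rewrite lerDl oppr_ge0 leNgt e0.
have [d d0 Ad] := Ae; exists d => // i; have := Ad i.
rewrite mulmx_addscalar => h; apply: lt_le_trans h _.
by rewrite gerDl mulr_le0_ge0 ?subr_le0 ?ltW.
Qed.

(** * Contraction of the differences of solutions *)

Lemma bernoulli_inequality {R : realFieldType} (e : R) (k : nat) :
  0 <= e <= 1 -> 1 - e * k%:R <= (1 - e) ^+ k.
Proof.
move=> /andP[e0 e1]; elim: k => [|k IH]; first by rewrite mulr0 subr0.
have h : 0 <= e * (e * k%:R) by rewrite !mulr_ge0.
apply: (@le_trans _ _ ((1 - e) * (1 - e * k%:R))).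
  by rewrite -natr1; lra.
by rewrite exprS ler_wpM2l // subr_ge0.
Qed.

(** Bernoulli's inequality gives a suitable rate without taking roots. *)
Lemma exists_rate {R : realFieldType} (mu : R) (k : nat) :
  mu < 1 -> exists2 zeta, 0 < zeta < 1 & mu <= zeta ^+ k.
Proof.
move=> mu1; pose s : R := Num.min (1 - mu) 1.
have s0 : 0 < s by rewrite lt_min subr_gt0 mu1 /=.
have [smu s1] : s <= 1 - mu /\ s <= 1 by split; rewrite ge_min lexx ?orbT.
pose e : R := s / k.+2%:R.
have e0 : 0 < e by rewrite divr_gt0.
have ek : e * k.+2%:R = s by rewrite divfK.
have e1 : e < 1 by apply: lt_le_trans s1; rewrite -ek ltr_pMr // ltr1n.
exists (1 - e); first by lra.
apply: (@le_trans _ _ (1 - e * k%:R)); last first.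
  by apply: bernoulli_inequality; lra.
have : e * k.+2%:R = e * k%:R + e * 2%:R by rewrite -addn2 natrD mulrDr.
lra.
Qed.

Lemma history_norm_entry {R : realType} {N d : nat} (a : history R N d) i l :
  `|a i l| <= history_norm a.
Proof.
apply: le_trans (le_bigmax _ (fun i => `|row i a|) i).
rewrite [leRHS]mx_normrE.
by have := le_bigmax 0 (fun p => `|row i a p.1 p.2|) (0, l); rewrite /= mxE.
Qed.

Lemma history_norm_le {R : realType} {N d : nat} (a : history R N d) (B : R) :
  0 <= B -> (forall i l, `|a i l| <= B) -> history_norm a <= B.
Proof.
move=> B0 aB; apply: bigmax_le => // i _.
by rewrite [leLHS]mx_normrE; apply: bigmax_le => // p _; rewrite mxE.
Qed.

Lemma le_supabs {R : realType} (u : nat -> R) (B : R) (m : nat) :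
  (forall m, `|u m| <= B) -> `|u m| <= supabs u.
Proof.
move=> uB; apply: sup_ubound; last by exists m.
by exists B => _ [n _ <-].
Qed.

(** The inputs cancel in the difference; what remains is one row of the
    comparison matrix [diag c + [sum_k w L]] applied to any vector [B] that
    dominates all the delayed differences at once. *)
Lemma next_state_diff {R : realType} {N K : nat} (S : model R N K)
    (L : 'I_N -> 'I_N -> 'I_K -> R) (c : 'I_N -> R) (w : 'I_N -> 'I_N -> 'I_K -> R)
    (x y : 'I_N -> int -> R) (m : nat) (i : 'I_N) (B : 'I_N -> R) :
  (forall j k u v, `|activation S i j k u - activation S i j k v|
     <= L i j k * `|u - v|) ->
  `|leak S i m| <= c i ->
  (forall j k, `|weight S i j k m| <= w i j k) ->
  `|x i (m%:Z - (leak_delay S)%:Z) - y i (m%:Z - (leak_delay S)%:Z)| <= B i ->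
  (forall j k, `|x j (m%:Z - (delay S i j k m)%:Z)
                 - y j (m%:Z - (delay S i j k m)%:Z)| <= B j) ->
  `|next_state S x m i - next_state S y m i|
    <= c i * B i + \sum_j (\sum_k w i j k * L i j k) * B j.
Proof.
move=> fL lc ww xyi xyj.
have L0 j k : 0 <= L i j k.
  by have := le_trans (normr_ge0 _) (fL j k 1 0); rewrite subr0 normr1 mulr1.
rewrite /next_state opprD addrACA subrr addr0 opprD addrACA.
apply: le_trans (ler_normD _ _) _; apply: lerD.
  by rewrite -mulrBr normrM ler_pM.
rewrite -sumrB; apply: le_trans (ler_norm_sum _ _ _) _; apply: ler_sum => j _.
rewrite -sumrB mulr_suml; apply: le_trans (ler_norm_sum _ _ _) _.
apply: ler_sum => k _; rewrite -mulrBr normrM -mulrA ler_pM //.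
by apply: le_trans (fL _ _ _ _) _; exact: ler_wpM2l.
Qed.

(** Times are written [n - T] so that exponents stay natural numbers and the
    induction on [n] covers the history, [n <= T], and the dynamics alike. *)
Lemma difference_decay {R : realType} {N K : nat} (S : model R N K)
    (L : 'I_N -> 'I_N -> 'I_K -> R) (c : 'I_N -> R) (w : 'I_N -> 'I_N -> 'I_K -> R)
    (d : 'I_N -> R) (T : nat) (zeta D : R) (x y : 'I_N -> int -> R) :
  (forall i j k u v, `|activation S i j k u - activation S i j k v|
     <= L i j k * `|u - v|) ->
  (forall i m, `|leak S i m| <= c i) ->
  (forall i j k m, `|weight S i j k m| <= w i j k) ->
  (leak_delay S <= T)%N -> (forall i j k m, (delay S i j k m <= T)%N) ->
  0 < zeta < 1 -> 0 <= D -> (forall i, 0 < d i) ->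
  (forall i, c i * d i + \sum_j (\sum_k w i j k * L i j k) * d j
     <= zeta ^+ T.+1 * d i) ->
  (forall m i, x i m.+1%:Z = next_state S x m i) ->
  (forall m i, y i m.+1%:Z = next_state S y m i) ->
  (forall n i, (n <= T)%N ->
     `|x i (n%:Z - T%:Z) - y i (n%:Z - T%:Z)| <= D * zeta ^+ n * d i) ->
  forall n i, `|x i (n%:Z - T%:Z) - y i (n%:Z - T%:Z)| <= D * zeta ^+ n * d i.
Proof.
move=> fL lc ww lT dT /andP[z0 z1] D0 d0 contr xS yS init.
elim/ltn_ind => n IH i; have [nT|Tn] := leqP n T; first exact: init.
pose m := (n - T.+1)%N.
have nE : n = (m + T.+1)%N by rewrite subnK.
have -> : n%:Z - T%:Z = m.+1%:Z by lia.
have past (t : nat) j : (t <= T)%N ->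
    `|x j (m%:Z - t%:Z) - y j (m%:Z - t%:Z)| <= D * zeta ^+ m * d j.
  move=> tT; have -> : m%:Z - t%:Z = (m + (T - t))%N%:Z - T%:Z by lia.
  apply: le_trans (IH _ _ j) _; first by lia.
  apply: ler_wpM2r; first exact: ltW.
  apply: ler_wpM2l => //; apply: ler_wiXn2l; rewrite ?ltW //.
  exact: leq_addr.
rewrite xS yS; apply: le_trans.
  apply: (@next_state_diff _ _ _ S L c w x y m i (fun j => D * zeta ^+ m * d j)) => //.
  - exact: past.
  - by move=> j k; apply: past.
have -> : c i * (D * zeta ^+ m * d i)
    + \sum_j (\sum_k w i j k * L i j k) * (D * zeta ^+ m * d j)
  = D * zeta ^+ m * (c i * d i + \sum_j (\sum_k w i j k * L i j k) * d j).
  rewrite mulrDr mulr_sumr mulrCA; congr (_ + _).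
  by apply: eq_bigr => j _; rewrite mulrCA.
rewrite nE exprD (mulrA D) -(mulrA _ (zeta ^+ T.+1)) ler_wpM2l //.
by rewrite mulr_ge0 // exprn_ge0 // ltW.
Qed.

Lemma stability_matrix_mulmxE {R : realType} {N K : nat}
    (c : 'I_N -> nat -> R)
    (b : 'I_N -> 'I_N -> 'I_K -> nat -> R) (F : 'I_N -> 'I_N -> 'I_K -> R)
    (d : 'cV[R]_N) i :
  (stability_matrix c b F *m d) i 0 = d i 0 - (supabs (c i) * d i 0
    + \sum_j (\sum_k supabs (b i j k) * F i j k) * d j 0).
Proof.
rewrite !mulmxBl mul1mx mul_diag_mx !mxE opprD addrA; congr (_ - _).
by apply: eq_bigr => j _; rewrite mxE.
Qed.

(** * Global exponential stability *)

Theorem corollary1 (R : realType) (N K : nat) (hN : (0 < N)%N) (hK : (0 < K)%N)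
    (tau : nat) (c : 'I_N -> nat -> R)
    (tauD : 'I_N -> 'I_N -> 'I_K -> nat -> nat)
    (b : 'I_N -> 'I_N -> 'I_K -> nat -> R) (inp : 'I_N -> nat -> R)
    (f : 'I_N -> 'I_N -> 'I_K -> R -> R) (F : 'I_N -> 'I_N -> 'I_K -> R)
    (hc : forall i m, -1 < c i m < 1)
    (hb : forall i j k, exists B : R, forall m, `|b i j k m| <= B)
    (htau : forall i j k, exists B : nat, forall m, (tauD i j k m <= B)%N)
    (hf : forall i j k (x y : R),
      `|f i j k x - f i j k y| <= F i j k * `|x - y|)
    (hM : nonsingular_M_matrix (stability_matrix c b F)) :
  globally_exponentially_stable (Model c tau tauD b f inp).
Proof.
set S := Model c tau tauD b f inp; set T := max_delay S.
have [lT dT] : (leak_delay S <= T)%N /\ forall i j k m, (delay S i j k m <= T)%N.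
  exact: (@max_delay_ub _ _ _ S).
have [d d0 Md] := nonsingular_M_matrix_semipositive _ hM.
pose p i := supabs (c i) * d i 0
  + \sum_j (\sum_k supabs (b i j k) * F i j k) * d j 0.
have pd i : 0 < 1 - p i / d i 0.
  rewrite subr_gt0 ltr_pdivrMr // mul1r -subr_gt0.
  by have := Md i; rewrite stability_matrix_mulmxE.
have [e e0 ep] := fin_pos_lower_bound _ pd.
have [zeta /andP[z0 z1] ze] : exists2 zeta : R, 0 < zeta < 1 & 1 - e <= zeta ^+ T.+1.
  by apply: exists_rate; rewrite gtrDl oppr_lt0.
have contr i : p i <= zeta ^+ T.+1 * d i 0.
  rewrite -ler_pdivrMr //; apply: le_trans ze.
  by have := ep i; lra.
have [dmin dmin0 dminP] := fin_pos_lower_bound _ d0.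
pose dmax := \sum_j d j 0.
have dmaxP i : d i 0 <= dmax.
  by rewrite /dmax (bigD1 i) //= lerDl sumr_ge0 // => j _; exact: ltW.
have dmax0 : 0 < dmax by apply: lt_le_trans (dmaxP (Ordinal hN)).
pose C := dmax / (dmin * zeta ^+ T).
have zT0 : 0 < zeta ^+ T by rewrite exprn_gt0.
have C0 : 0 < C by rewrite divr_gt0 // mulr_gt0.
exists C, zeta; split=> //; split=> [|u v m]; first by rewrite z0.
have uv0 : 0 <= history_norm (u - v).
  exact: le_trans (history_norm_entry _ (Ordinal hN) ord0).
(* At times [n - T <= 0] the bound [D zeta ^ n d_i] must dominate the history
   norm; its worst case is [n = T] with the least [d_i]. *)
pose D := history_norm (u - v) / (dmin * zeta ^+ T).
have D0 : 0 <= D by rewrite divr_ge0 // mulr_ge0 // ltW.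
have [u0 uS] : is_solution S u (solution S u) := svalP (cid (solution_exists S u)).
have [v0 vS] : is_solution S v (solution S v) := svalP (cid (solution_exists S v)).
have bound n i : `|solution S u i (n%:Z - T%:Z) - solution S v i (n%:Z - T%:Z)|
    <= D * zeta ^+ n * d i 0.
  apply: (@difference_decay _ _ _ S F (fun i => supabs (c i))
    (fun i j k => supabs (b i j k)) (fun j => d j 0) T zeta D
    (solution S u) (solution S v)) => //.
  - move=> {}i k; apply: (@le_supabs _ _ 1) => l.
    by rewrite ler_norml; have /andP[/ltW -> /ltW ->] := hc i l.
  - by move=> {}i j k l; have [B hB] := hb i j k; apply: le_supabs hB.
  - by rewrite z0.
  move=> {}n {}i nT.
  have lt : (T - n < T.+1)%N by lia.
  have -> : n%:Z - T%:Z = 0%:Z - (Ordinal lt)%:Z by rewrite /=; lia.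
  have uE : solution S u i (0%:Z - (Ordinal lt)%:Z) = u i (Ordinal lt).
    by rewrite -{2}u0 mxE.
  have vE : solution S v i (0%:Z - (Ordinal lt)%:Z) = v i (Ordinal lt).
    by rewrite -{2}v0 mxE.
  rewrite uE vE; have := history_norm_entry (u - v) i (Ordinal lt).
  rewrite !mxE => /le_trans; apply.
  rewrite /D -!mulrA ler_peMr // ler_pdivlMl ?mulr_gt0 // mulr1 mulrC.
  have zTn : zeta ^+ T <= zeta ^+ n by apply: ler_wiXn2l; rewrite ?ltW.
  by apply: ler_pM => //; exact: ltW.
apply: history_norm_le => [|i l].
  apply: mulr_ge0 => //; apply: mulr_ge0; first exact: ltW.
  by rewrite exprn_ge0 // ltW.
rewrite !mxE.
have lT' := ltn_ord l.
have -> : m%:Z - l%:Z = (m + (T - l))%N%:Z - T%:Z by lia.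
apply: le_trans (bound _ _) _.
have -> : C * zeta ^+ m * history_norm (u - v) = D * zeta ^+ m * dmax.
  by rewrite /C /D; ring.
apply: ler_pM => //; first by rewrite mulr_ge0 // exprn_ge0 // ltW.
  exact: ltW.
apply: ler_wpM2l => //; apply: ler_wiXn2l; rewrite ?ltW //.
exact: leq_addr.
Qed.
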